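(* For any bipullback $$\begin{array}{ccc}\frac{W}{L}&\xrightarrow{\ \frac{\gamma}{\mu}\ }&\frac{X}{G}\\ {\scriptstyle\frac{\delta}{\nu}}\downarrow\ \ &&\ \ \downarrow{\scriptstyle\frac{\alpha}{\theta}}\\ \frac{Y}{H}&\xrightarrow{\ \frac{\beta}{\tau}\ }&\frac{Z}{K}\end{array}$$ in $\mathbb{S}$, with 2-cell $\kappa\colon\frac{\alpha}{\theta}\circ\frac{\gamma}{\mu}\Rightarrow\frac{\beta}{\tau}\circ\frac{\delta}{\nu}$, there are the following natural isomorphisms of functors ${}_G\mathrm{set}/X\to{}_H\mathrm{set}/Y$. (i) $(\frac{\beta}{\tau})^*\circ(\frac{\alpha}{\theta})_+\cong(\frac{\delta}{\nu})_+\circ(\frac{\gamma}{\mu})^*$. (ii) $(\frac{\beta}{\tau})^*\circ(\frac{\alpha}{\theta})_\bullet\cong(\frac{\delta}{\nu})_\bullet\circ(\frac{\gamma}{\mu})^*$.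
   Context: For a finite group $G$, ${}_G\mathrm{set}$ is the category of finite $G$-sets and $G$-maps; objects of the slice category ${}_G\mathrm{set}/X$ are written $(A,\mathfrak{a})$ with $\mathfrak{a}\colon A\to X$ a $G$-map. The strict 2-category $\mathbb{S}$. A 0-cell is a pair of a finite group $G$ and a finite $G$-set $X$, denoted $\frac{X}{G}$ (a formal symbol). A 1-cell $\frac{\alpha}{\theta}\colon\frac{X}{G}\to\frac{Y}{H}$ is a pair of a map $\alpha\colon X\to Y$ and a family of maps $\theta=\{\theta_x\colon G\to H\}_{x\in X}$ with $\alpha(gx)=\theta_x(g)\alpha(x)$ and $\theta_x(gg')=\theta_{g'x}(g)\theta_x(g')$ for all $x\in X$, $g,g'\in G$. Composition: $\frac{\beta}{\tau}\circ\frac{\alpha}{\theta}=\frac{\beta\circ\alpha}{\tau\circ\theta}$, where $(\tau\circ\theta)_x=\tau_{\alpha(x)}\circ\theta_x$. A 2-cell $\varepsilon\colon\frac{\alpha}{\theta}\Rightarrow\frac{\alpha'}{\theta'}$ between 1-cells $\frac{X}{G}\to\frac{Y}{H}$ is a family $\{\varepsilon_x\in H\}_{x\in X}$ with $\alpha'(x)=\varepsilon_x\alpha(x)$ and $\varepsilon_{gx}\theta_x(g)\varepsilon_x^{-1}=\theta'_x(g)$ for all $x\in X,g\in G$. Vertical composition: $(\varepsilon'\cdot\varepsilon)_x=\varepsilon'_x\varepsilon_x$; all 2-cells are invertible. Whiskering: $(\frac{\beta}{\tau}\circ\varepsilon)_x=\tau_{\alpha(x)}(\varepsilon_x)$ and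 $(\delta\circ\frac{\alpha}{\theta})_x=\delta_{\alpha(x)}$. Bipullback. In a strict 2-category with invertible 2-cells, a bipullback of 1-cells $f_i\colon A_i\to B$ ($i=1,2$) is a 0-cell $P$ with 1-cells $\pi_i\colon P\to A_i$ and a 2-cell $\kappa\colon f_1\circ\pi_1\Rightarrow f_2\circ\pi_2$ such that: (i) for any 0-cell $Q$, 1-cells $g_i\colon Q\to A_i$ and 2-cell $\varepsilon\colon f_1\circ g_1\Rightarrow f_2\circ g_2$, there are a 1-cell $g\colon Q\to P$ and 2-cells $\xi_i\colon\pi_i\circ g\Rightarrow g_i$ with $\varepsilon\cdot(f_1\circ\xi_1)=(f_2\circ\xi_2)\cdot(\kappa\circ g)$; (ii) for any two such triplets $(g,\xi_1,\xi_2)$, $(g',\xi_1',\xi_2')$ there is a unique 2-cell $\zeta\colon g\Rightarrow g'$ with $\xi_i'\cdot(\pi_i\circ\zeta)=\xi_i$ ($i=1,2$). Functors attached to a 1-cell $\frac{\alpha}{\theta}\colon\frac{X}{G}\to\frac{Y}{H}$. $(\frac{\alpha}{\theta})^*\colon{}_H\mathrm{set}/Y\to{}_G\mathrm{set}/X$ sends $(B,\mathfrak{b})$ to the set $X\times_YB=\{(x,b)\mid\alpha(x)=\mathfrak{b}(b)\}$ with $G$-action $g(x,b)=(gx,\theta_x(g)b)$ and the projection to $X$, and sends a morphism $f$ to $(x,b)\mapsto(x,f(b))$. For $(A,\mathfrak{a})\in{}_G\mathrm{set}/X$, let $H\times_GA=(H\times A)/\sim$, where $(\eta,a)\sim(\eta',a')$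 iff there is $g\in G$ with $a'=ga$ and $\eta=\eta'\theta_{\mathfrak{a}(a)}(g)$; the class of $(\eta,a)$ is $[\eta,a]$ and $H$ acts by $h[\eta,a]=[h\eta,a]$. For $(A,\mathfrak{a})=(X,\mathrm{id}_X)$ put $\mathrm{SIm}(\frac{\alpha}{\theta})=H\times_GX$, and let $\widetilde{\alpha}\colon\mathrm{SIm}(\frac{\alpha}{\theta})\to Y$ be the $H$-map $[\eta,x]\mapsto\eta\alpha(x)$. The functor $S_\theta\colon{}_G\mathrm{set}/X\to{}_H\mathrm{set}/\mathrm{SIm}(\frac{\alpha}{\theta})$ sends $(A,\mathfrak{a})$ to $H\times_GA\to H\times_GX$, $[\eta,a]\mapsto[\eta,\mathfrak{a}(a)]$, and $f$ to $[\eta,a]\mapsto[\eta,f(a)]$. The functor $(\frac{\alpha}{\theta})_+\colon{}_G\mathrm{set}/X\to{}_H\mathrm{set}/Y$ is $S_\theta$ followed by composition with $\widetilde{\alpha}$. The endofunctor $(-)^\theta$ of ${}_G\mathrm{set}/X$ sends $(A,\mathfrak{a})$ to $(A^\theta,\mathfrak{a}|_{A^\theta})$, where $A^\theta\subseteq A$ is the $G$-subset of those $a\in A$ such that for all $g,g'\in G$: if $\theta_{\mathfrak{a}(a)}(g)=\theta_{\mathfrak{a}(a)}(g')$ and $g\mathfrak{a}(a)=g'\mathfrak{a}(a)$, then $ga=g'a$. It sends a morphism $f$ to its restriction $f|_{A^\theta}$. For an $H$-map $f\colon V\to Y$, the functor $\Pi_f\colon{}_H\mathrm{set}/V\to{}_H\mathrm{set}/Y$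 sends $(B,\mathfrak{b})$ to the set $\Pi_f(B)$ of pairs $(y,\sigma)$ with $y\in Y$ and $\sigma\colon f^{-1}(y)\to B$ a map such that $\mathfrak{b}\circ\sigma$ is the inclusion $f^{-1}(y)\hookrightarrow V$, with $H$-action $h(y,\sigma)=(hy,{}^h\sigma)$, ${}^h\sigma(v)=h\sigma(h^{-1}v)$, and with the projection to $Y$; it sends a morphism $k$ to $(y,\sigma)\mapsto(y,k\circ\sigma)$. The functor $(\frac{\alpha}{\theta})_\bullet$ is the composition $\Pi_{\widetilde{\alpha}}\circ S_\theta\circ(-)^\theta\colon{}_G\mathrm{set}/X\to{}_H\mathrm{set}/Y$. *)

(* Defs.v *)
(* boolp provides functional extensionality and proof irrelevance, so that
   morphisms can be compared with Leibniz equality (slice_homP). *)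
From HB Require Import structures.
From mathcomp Require Import all_boot all_fingroup.
From mathcomp Require Import generic_quotient boolp.

Set Implicit Arguments.
Unset Strict Implicit.
Unset Printing Implicit Defensive.

Local Open Scope group_scope.
Local Open Scope quotient_scope.

(* MathComp actions are right actions; finite G-sets here are left G-sets. *)
Record gset (G : finGroupType) := Gset {
  gset_sort :> finType;
  gact : G -> gset_sort -> gset_sort;
  gact1 : forall x, gact 1 x = x;
  gactM : forall g h x, gact (g * h) x = gact g (gact h x) }.

Notation "g *> x" := (gact g x) (at level 39, right associativity).

Lemma gactK (G : finGroupType) (X : gset G) (g : G) :
  cancel (@gact G X g) (@gact G X g^-1).
Proof. by move=> x; rewrite -gactM mulVg gact1. Qed.

Lemma gactKV (G : finGroupType) (X : gset G) (g : G) :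
  cancel (@gact G X g^-1) (@gact G X g).
Proof. by move=> x; rewrite -gactM mulgV gact1. Qed.

Record gmap (G : finGroupType) (X Y : gset G) := Gmap {
  gmap_fun :> X -> Y;
  gmapE : forall g x, gmap_fun (g *> x) = g *> gmap_fun x }.

Definition gmap_id (G : finGroupType) (X : gset G) : gmap X X :=
  @Gmap G X X id (fun _ _ => erefl).

Lemma gmap_comp_subproof (G : finGroupType) (X Y Z : gset G)
  (f : gmap Y Z) (e : gmap X Y) g x : f (e (g *> x)) = g *> f (e x).
Proof. by rewrite !gmapE. Qed.

Definition gmap_comp (G : finGroupType) (X Y Z : gset G)
  (f : gmap Y Z) (e : gmap X Y) : gmap X Z :=
  Gmap (gmap_comp_subproof f e).

Record category := Category {
  obj :> Type;
  hom : obj -> obj -> Type;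
  idc : forall A, hom A A;
  compc : forall A B C, hom B C -> hom A B -> hom A C;
  comp1c : forall A B (f : hom A B), compc (idc B) f = f;
  compc1 : forall A B (f : hom A B), compc f (idc A) = f;
  compcA : forall A B C D (f : hom C D) (g : hom B C) (h : hom A B),
    compc f (compc g h) = compc (compc f g) h }.

Record functor (C D : category) := Functor {
  fob :> C -> D;
  fmap : forall A B : C, hom A B -> hom (fob A) (fob B);
  fmap_id : forall A, fmap (idc A) = idc (fob A);
  fmap_comp : forall (A B E : C) (f : hom B E) (g : hom A B),
    fmap (compc f g) = compc (fmap f) (fmap g) }.

Section FunctorComp.
Variables (C D E : category) (F : functor D E) (F' : functor C D).

Lemma fcomp_id_subproof (A : C) : fmap F (fmap F' (idc A)) = idc (F (F' A)).
Proof. by rewrite !fmap_id. Qed.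

Lemma fcomp_comp_subproof (A B B' : C) (f : hom B B') (g : hom A B) :
  fmap F (fmap F' (compc f g)) =
  compc (fmap F (fmap F' f)) (fmap F (fmap F' g)).
Proof. by rewrite !fmap_comp. Qed.

Definition fcomp : functor C E :=
  @Functor C E (fun A => F (F' A)) (fun A B f => fmap F (fmap F' f))
    fcomp_id_subproof fcomp_comp_subproof.
End FunctorComp.

Declare Scope functor_scope.
Delimit Scope functor_scope with F.
Notation "F \of F'" := (fcomp F F')
  (at level 50, left associativity) : functor_scope.

Definition is_iso (C : category) (A B : C) (f : hom A B) : Prop :=
  exists g : hom B A, compc g f = idc A /\ compc f g = idc B.

Definition nat_isomorphic (C D : category) (F F' : functor C D) : Prop :=
  exists eta : forall A : C, hom (F A) (F' A),
    (forall (A B : C) (f : hom A B),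
        compc (fmap F' f) (eta A) = compc (eta B) (fmap F f)) /\
    (forall A : C, is_iso (eta A)).

Notation "F ≅ F'" := (nat_isomorphic F F') (at level 70) : functor_scope.

Record slice_obj (G : finGroupType) (X : gset G) := SliceObj {
  stot :> gset G;
  sproj : gmap stot X }.

Record slice_hom (G : finGroupType) (X : gset G) (A B : slice_obj X) :=
  SliceHom {
    shom_map :> gmap A B;
    shomE : forall a, sproj B (shom_map a) = sproj A a }.

Lemma slice_homP (G : finGroupType) (X : gset G) (A B : slice_obj X)
  (f g : slice_hom A B) : f =1 g -> f = g.
Proof.
case: f => -[f fe] fo; case: g => -[g ge] go /= /funext efg.
move: fe fo ge go; rewrite {}efg => fe fo ge go.
rewrite (Prop_irrelevance fe ge) in fo *.
by rewrite (Prop_irrelevance fo go).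
Qed.

Section Slice.
Variables (G : finGroupType) (X : gset G).

Definition slice_id (A : slice_obj X) : slice_hom A A :=
  @SliceHom G X A A (gmap_id A) (fun _ => erefl).

Lemma slice_comp_subproof (A B C : slice_obj X)
  (f : slice_hom B C) (g : slice_hom A B) a :
  sproj C (gmap_comp f g a) = sproj A a.
Proof. by rewrite /= !shomE. Qed.

Definition slice_comp (A B C : slice_obj X)
  (f : slice_hom B C) (g : slice_hom A B) : slice_hom A C :=
  SliceHom (slice_comp_subproof f g).

Definition slice : category.
Proof.
by refine (@Category (slice_obj X) (@slice_hom G X) slice_id slice_comp _ _ _)
  => *; exact: slice_homP.
Defined.
End Slice.

(* A 0-cell X/G of the 2-category is just X : gset G, with G implicit in the
   type of X. *)

Record cell1 (G H : finGroupType) (X : gset G) (Y : gset H) := Cell1 {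
  c1fun :> X -> Y;
  c1grp : X -> G -> H;
  c1funE : forall g x, c1fun (g *> x) = c1grp x g *> c1fun x;
  c1grpM : forall x g g', c1grp x (g * g') = c1grp (g' *> x) g * c1grp x g' }.

Section Cell1Comp.
Variables (G H K : finGroupType) (X : gset G) (Y : gset H) (Z : gset K).
Variables (b : cell1 Y Z) (a : cell1 X Y).

Lemma c1comp_fun_subproof g x :
  b (a (g *> x)) = c1grp b (a x) (c1grp a x g) *> b (a x).
Proof. by rewrite !c1funE. Qed.

Lemma c1comp_grp_subproof x g g' :
  c1grp b (a x) (c1grp a x (g * g')) =
  c1grp b (a (g' *> x)) (c1grp a (g' *> x) g) *
  c1grp b (a x) (c1grp a x g').
Proof. by rewrite c1grpM c1grpM -c1funE. Qed.

Definition c1comp : cell1 X Z :=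
  @Cell1 G K X Z (fun x => b (a x)) (fun x g => c1grp b (a x) (c1grp a x g))
    c1comp_fun_subproof c1comp_grp_subproof.
End Cell1Comp.

Declare Scope cell_scope.
Delimit Scope cell_scope with cell.
Notation "b \o a" := (c1comp b a) : cell_scope.

Definition is_cell2 (G H : finGroupType) (X : gset G) (Y : gset H)
    (a a' : cell1 X Y) (e : X -> H) : Prop :=
  (forall x, a' x = e x *> a x) /\
  (forall x g, e (g *> x) * c1grp a x g * (e x)^-1 = c1grp a' x g).

(* As is_cell2 only involves the components of a and a', the types
   cell2 (f \o (g \o h)) k and cell2 ((f \o g) \o h) k are convertible. *)
Definition cell2 (G H : finGroupType) (X : gset G) (Y : gset H)
  (a a' : cell1 X Y) : Type := {e : X -> H | is_cell2 a a' e}.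

Definition c2eq (G H : finGroupType) (X : gset G) (Y : gset H)
  (a a' : cell1 X Y) (e e' : cell2 a a') : Prop := sval e =1 sval e'.

Section Cell2Ops.
Variables (G H K : finGroupType) (X : gset G) (Y : gset H) (Z : gset K).

Lemma vcomp_subproof (a a' a'' : cell1 X Y)
  (e' : cell2 a' a'') (e : cell2 a a') :
  is_cell2 a a'' (fun x => sval e' x * sval e x).
Proof.
case: e' e => [e' [e'1 e'2]] [e [e1 e2]]; split=> [x|x g] /=.
  by rewrite e'1 e1 gactM.
by rewrite -e'2 -e2 invMg !mulgA.
Qed.

Definition vcomp (a a' a'' : cell1 X Y)
  (e' : cell2 a' a'') (e : cell2 a a') : cell2 a a'' :=
  exist _ _ (vcomp_subproof e' e).

Lemma c1grp1 (b : cell1 Y Z) y : c1grp b y 1 = 1.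
Proof.
apply: (mulgI (c1grp b y 1)); rewrite mulg1.
by rewrite -[in RHS](mulg1 1) c1grpM gact1.
Qed.

Lemma c1grpV (b : cell1 Y Z) y h : c1grp b (h *> y) h^-1 = (c1grp b y h)^-1.
Proof.
apply: (mulIg (c1grp b y h)).
by rewrite -c1grpM !mulVg c1grp1.
Qed.

Lemma whiskerL_subproof (b : cell1 Y Z) (a a' : cell1 X Y) (e : cell2 a a') :
  is_cell2 (c1comp b a) (c1comp b a') (fun x => c1grp b (a x) (sval e x)).
Proof.
case: e => [e [e1 e2]]; split=> [x|x g] /=; first by rewrite e1 c1funE.
rewrite -e2 e1 !c1grpM c1grpV gactK -!mulgA; congr (_ * _).
  by rewrite c1funE.
Qed.

Definition whiskerL (b : cell1 Y Z) (a a' : cell1 X Y) (e : cell2 a a') :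
  cell2 (c1comp b a) (c1comp b a') := exist _ _ (whiskerL_subproof b e).

Lemma whiskerR_subproof (b b' : cell1 Y Z) (d : cell2 b b') (a : cell1 X Y) :
  is_cell2 (c1comp b a) (c1comp b' a) (fun x => sval d (a x)).
Proof.
case: d => [d [d1 d2]]; split=> [x|x g] /=; first exact: d1.
by rewrite c1funE d2.
Qed.

Definition whiskerR (b b' : cell1 Y Z) (d : cell2 b b') (a : cell1 X Y) :
  cell2 (c1comp b a) (c1comp b' a) := exist _ _ (whiskerR_subproof d a).
End Cell2Ops.

Notation "e' \v e" := (vcomp e' e)
  (at level 50, left associativity) : cell_scope.
Notation "b \wl e" := (whiskerL b e) (at level 40) : cell_scope.
Notation "d \wr a" := (whiskerR d a) (at level 40) : cell_scope.
Notation "e ≡ e'" := (c2eq e e') (at level 70) : cell_scope.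

Section Bipullback.
Local Open Scope cell_scope.
Variables (G1 G2 K L : finGroupType).
Variables (A1 : gset G1) (A2 : gset G2) (B : gset K) (P : gset L).
Variables (f1 : cell1 A1 B) (f2 : cell1 A2 B).
Variables (p1 : cell1 P A1) (p2 : cell1 P A2) (k : cell2 (f1 \o p1) (f2 \o p2)).

Definition bipb_factor (N : finGroupType) (Q : gset N)
    (g1 : cell1 Q A1) (g2 : cell1 Q A2) (e : cell2 (f1 \o g1) (f2 \o g2))
    (g : cell1 Q P) (x1 : cell2 (p1 \o g) g1) (x2 : cell2 (p2 \o g) g2) :
    Prop :=
  e \v (f1 \wl x1) ≡ (f2 \wl x2) \v (k \wr g).

Definition is_bipullback : Prop :=
  forall (N : finGroupType) (Q : gset N)
    (g1 : cell1 Q A1) (g2 : cell1 Q A2) (e : cell2 (f1 \o g1) (f2 \o g2)),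
  (exists (g : cell1 Q P) (x1 : cell2 (p1 \o g) g1) (x2 : cell2 (p2 \o g) g2),
     bipb_factor e x1 x2) /\
  (forall (g g' : cell1 Q P)
     (x1 : cell2 (p1 \o g) g1) (x2 : cell2 (p2 \o g) g2)
     (x1' : cell2 (p1 \o g') g1) (x2' : cell2 (p2 \o g') g2),
   bipb_factor e x1 x2 -> bipb_factor e x1' x2' ->
   exists z : cell2 g g',
     (x1' \v (p1 \wl z) ≡ x1 /\ x2' \v (p2 \wl z) ≡ x2) /\
     (forall z' : cell2 g g',
        x1' \v (p1 \wl z') ≡ x1 /\ x2' \v (p2 \wl z') ≡ x2 -> z' ≡ z)).
End Bipullback.

Section Pullback.
Variables (G H : finGroupType) (X : gset G) (Y : gset H) (a : cell1 X Y).

Section PullObj.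
Variable (B : slice_obj Y).

Definition pull_set : finType := {p : X * B | a p.1 == sproj B p.2}.

Lemma pull_act_subproof g (p : pull_set) :
  a (g *> (val p).1) ==
  sproj B (c1grp a (val p).1 g *> (val p).2).
Proof. by rewrite gmapE c1funE (eqP (valP p)). Qed.

Definition pull_act g (p : pull_set) : pull_set :=
  exist _ (g *> (val p).1, c1grp a (val p).1 g *> (val p).2)
    (pull_act_subproof g p).

Lemma pull_act1 p : pull_act 1 p = p.
Proof.
by apply: val_inj; case: p => -[x b] xb /=; rewrite c1grp1 !gact1.
Qed.

Lemma pull_actM g g' p : pull_act (g * g') p = pull_act g (pull_act g' p).
Proof. by apply: val_inj; case: p => -[x b] xb /=; rewrite c1grpM !gactM. Qed.

Definition pull_gset : gset G := Gset pull_act1 pull_actM.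

Definition pull_proj : gmap pull_gset X :=
  @Gmap G pull_gset X (fun p : pull_set => (val p).1) (fun _ _ => erefl).

Definition pull_obj : slice_obj X := SliceObj pull_proj.
End PullObj.

Section PullHom.
Variables (B B' : slice_obj Y) (f : slice_hom B B').

Lemma pull_fun_subproof (p : pull_obj B) :
  a (val p).1 == sproj B' (f (val p).2).
Proof. by rewrite shomE (eqP (valP p)). Qed.

Definition pull_fun (p : pull_obj B) : pull_obj B' :=
  exist _ ((val p).1, f (val p).2) (pull_fun_subproof p).

Lemma pull_funE g p : pull_fun (g *> p) = g *> pull_fun p.
Proof. by apply: val_inj; rewrite /= gmapE. Qed.

Definition pull_hom : slice_hom (pull_obj B) (pull_obj B') :=
  @SliceHom G X (pull_obj B) (pull_obj B') (Gmap pull_funE) (fun _ => erefl).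
End PullHom.

Definition pull : functor (slice Y) (slice X).
Proof.
refine (@Functor (slice Y) (slice X) pull_obj pull_hom _ _).
- by move=> B; apply: slice_homP => -[[x b] xb]; apply: val_inj.
- by move=> *; apply: slice_homP => -[[x b] xb]; apply: val_inj.
Defined.
End Pullback.

#[warning="-redundant-canonical-projection"]
HB.instance Definition _ (T : finType) (e : equiv_rel T) :=
  Finite.copy {eq_quot e} (can_type (@EquivQuot.ereprK _ _ _ _ e _)).

Section Induction.
Variables (G H : finGroupType) (X : gset G) (Y : gset H) (a : cell1 X Y).

Section IndObj.
Variable (A : slice_obj X).

Definition ind_rel : rel (H * A) := fun p q =>
  [exists g : G, (q.2 == g *> p.2) && (p.1 == q.1 * c1grp a (sproj A p.2) g)].

Lemma ind_relP (p q : H * A) :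
  reflect (exists g : G, q.2 = g *> p.2 /\ p.1 = q.1 * c1grp a (sproj A p.2) g)
    (ind_rel p q).
Proof.
apply: (iffP existsP) => -[g]; first by case/andP=> /eqP ? /eqP ?; exists g.
by case=> -> e; exists g; rewrite eqxx /= -e.
Qed.

Lemma ind_rel_refl : reflexive ind_rel.
Proof. by move=> p; apply/ind_relP; exists 1; rewrite gact1 c1grp1 mulg1. Qed.

Lemma ind_rel_trans : transitive ind_rel.
Proof.
move=> q p r /ind_relP[g [eg1 eg2]] /ind_relP[g' [eg'1 eg'2]].
apply/ind_relP; exists (g' * g); split; first by rewrite gactM -eg1.
by rewrite eg2 eg'2 eg1 gmapE c1grpM mulgA.
Qed.

Lemma ind_rel_sym : symmetric ind_rel.
Proof.
suff s p q : ind_rel p q -> ind_rel q p by move=> p q; apply/idP/idP; apply: s.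
move=> /ind_relP[g [e1 e2]]; apply/ind_relP; exists g^-1.
by rewrite e2 e1 gactK gmapE c1grpV mulgK.
Qed.

Definition ind_eqv : equiv_rel (H * A) :=
  EquivRel ind_rel ind_rel_refl ind_rel_sym ind_rel_trans.

Definition ind_set : finType := {eq_quot ind_eqv}.

Definition ind_class (h : H) (x : A) : ind_set := \pi_{eq_quot ind_eqv} (h, x).

Lemma ind_classP h x h' x' :
  ind_class h x = ind_class h' x' <->
  exists g : G, x' = g *> x /\ h = h' * c1grp a (sproj A x) g.
Proof.
split=> [/eqmodP /ind_relP //|e].
by apply/eqmodP/ind_relP.
Qed.

Lemma ind_class_repr (c : ind_set) : ind_class (repr c).1 (repr c).2 = c.
Proof. by rewrite /ind_class -surjective_pairing reprK. Qed.

Lemma ind_ind (P : ind_set -> Prop) :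
  (forall h x, P (ind_class h x)) -> forall c, P c.
Proof. by move=> Pc c; rewrite -(ind_class_repr c). Qed.

Definition ind_act (h : H) (c : ind_set) : ind_set :=
  ind_class (h * (repr c).1) (repr c).2.

Lemma ind_actE h k x : ind_act h (ind_class k x) = ind_class (h * k) x.
Proof.
have /ind_classP[g [e1 e2]] := ind_class_repr (ind_class k x).
by apply/ind_classP; exists g; split=> //; rewrite e2 mulgA.
Qed.

Lemma ind_act1 c : ind_act 1 c = c.
Proof. by elim/ind_ind: c => h x; rewrite ind_actE mul1g. Qed.

Lemma ind_actM h k c : ind_act (h * k) c = ind_act h (ind_act k c).
Proof. by elim/ind_ind: c => h' x; rewrite !ind_actE mulgA. Qed.

Definition ind_gset : gset H := @Gset H ind_set ind_act ind_act1 ind_actM.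
End IndObj.

Section IndHom.
Variables (A B : slice_obj X) (f : slice_hom A B).

Definition ind_fun (c : ind_gset A) : ind_gset B :=
  ind_class (repr c).1 (f (repr c).2).

Lemma ind_fun_class h x : ind_fun (ind_class h x) = ind_class h (f x).
Proof.
have /ind_classP[g [e1 e2]] := ind_class_repr (ind_class h x).
by apply/ind_classP; exists g; rewrite shomE {1}e1 gmapE.
Qed.

Lemma ind_funE h c : ind_fun (h *> c) = h *> ind_fun c.
Proof.
by elim/ind_ind: c => k x; rewrite /= ind_actE !ind_fun_class ind_actE.
Qed.

Definition ind_map : gmap (ind_gset A) (ind_gset B) := Gmap ind_funE.
End IndHom.

Definition slice_top : slice_obj X := SliceObj (gmap_id X).

Definition slice_to_top (A : slice_obj X) : slice_hom A slice_top :=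
  @SliceHom G X A slice_top (sproj A) (fun _ => erefl).

Definition SIm : gset H := ind_gset slice_top.

Definition SIm_fun (c : SIm) : Y := (repr c).1 *> a (repr c).2.

Lemma SIm_fun_class (h : H) (x : X) :
  SIm_fun (@ind_class slice_top h x) = h *> a x.
Proof.
have /ind_classP[g [/= e1 e2]] := ind_class_repr (@ind_class slice_top h x).
by rewrite /SIm_fun e2 gactM -c1funE -e1.
Qed.

Lemma SIm_funE h c : SIm_fun (h *> c) = h *> SIm_fun c.
Proof.
by elim/ind_ind: c => k x; rewrite /= ind_actE !SIm_fun_class gactM.
Qed.

Definition SIm_map : gmap SIm Y := Gmap SIm_funE.

(* S_theta; the structure map [h, x] |-> [h, sproj x] of S_theta (A) is the
   map induced by the unique morphism from A to (X, id). *)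
Definition S_obj (A : slice_obj X) : slice_obj SIm :=
  @SliceObj H SIm (ind_gset A) (ind_map (slice_to_top A)).

Lemma S_hom_subproof (A B : slice_obj X) (f : slice_hom A B) c :
  sproj (S_obj B) (ind_map f c) = sproj (S_obj A) c.
Proof. by elim/ind_ind: c => h x; rewrite /= !ind_fun_class /= shomE. Qed.

Definition S_hom (A B : slice_obj X) (f : slice_hom A B) :
  slice_hom (S_obj A) (S_obj B) :=
  @SliceHom H SIm (S_obj A) (S_obj B) (ind_map f) (S_hom_subproof f).

Definition Sfun : functor (slice X) (slice SIm).
Proof.
refine (@Functor (slice X) (slice SIm) S_obj S_hom _ _).
- by move=> A; apply: slice_homP; elim/ind_ind=> h x; rewrite /= ind_fun_class.
- move=> A B C f g; apply: slice_homP; elim/ind_ind=> h x.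
  by rewrite /= !ind_fun_class.
Defined.
End Induction.

Section PostComp.
Variables (H : finGroupType) (V Y : gset H) (f : gmap V Y).

Definition post_obj (B : slice_obj V) : slice_obj Y :=
  SliceObj (gmap_comp f (sproj B)).

Lemma post_hom_subproof (B B' : slice_obj V) (k : slice_hom B B') b :
  sproj (post_obj B') (k b) = sproj (post_obj B) b.
Proof. by rewrite /= shomE. Qed.

Definition post_hom (B B' : slice_obj V) (k : slice_hom B B') :
  slice_hom (post_obj B) (post_obj B') :=
  @SliceHom H Y (post_obj B) (post_obj B') k (post_hom_subproof k).

Definition postcomp : functor (slice V) (slice Y).
Proof.
by refine (@Functor (slice V) (slice Y) post_obj post_hom _ _) => *;
  exact: slice_homP.
Defined.
End PostComp.

Definition push_plus (G H : finGroupType) (X : gset G) (Y : gset H)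
  (a : cell1 X Y) : functor (slice X) (slice Y) :=
  fcomp (postcomp (SIm_map a)) (Sfun a).

Section Theta.
Variables (G H : finGroupType) (X : gset G) (Y : gset H) (a : cell1 X Y).

Section ThetaObj.
Variable (A : slice_obj X).

Definition theta_pred : pred A := fun x =>
  [forall g : G, forall g' : G,
     [&& c1grp a (sproj A x) g == c1grp a (sproj A x) g'
       & g *> sproj A x == g' *> sproj A x]
     ==> (g *> x == g' *> x)].

Lemma theta_predP (x : A) :
  reflect
    (forall g g' : G, c1grp a (sproj A x) g = c1grp a (sproj A x) g' ->
       g *> sproj A x = g' *> sproj A x -> g *> x = g' *> x)
    (theta_pred x).
Proof.
apply: (iffP forallP) => [e g g' /eqP e1 /eqP e2|e g].
  by move/forallP/(_ g')/implyP: (e g); rewrite e1 e2 => /(_ isT)/eqP.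
by apply/forallP=> g'; apply/implyP=> /andP[/eqP e1 /eqP e2]; apply/eqP/e.
Qed.

Definition theta_set : finType := {x : A | theta_pred x}.

Lemma theta_act_subproof g (x : theta_set) : theta_pred (g *> val x).
Proof.
case: x => x /= /theta_predP ex; apply/theta_predP => k k'.
rewrite gmapE -!gactM => ek ek'; apply: ex => //.
by rewrite !c1grpM ek.
Qed.

Definition theta_act g (x : theta_set) : theta_set :=
  exist _ (g *> val x) (theta_act_subproof g x).

Lemma theta_act1 x : theta_act 1 x = x.
Proof. by apply: val_inj; rewrite /= gact1. Qed.

Lemma theta_actM g h x : theta_act (g * h) x = theta_act g (theta_act h x).
Proof. by apply: val_inj; rewrite /= gactM. Qed.

Definition theta_gset : gset G := Gset theta_act1 theta_actM.

Lemma theta_proj_subproof g (x : theta_gset) :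
  sproj A (val (g *> x)) = g *> sproj A (val x).
Proof. by rewrite /= gmapE. Qed.

Definition theta_obj : slice_obj X :=
  @SliceObj G X theta_gset
    (@Gmap G theta_gset X (fun x => sproj A (val x)) theta_proj_subproof).
End ThetaObj.

Section ThetaHom.
Variables (A B : slice_obj X) (f : slice_hom A B).

Lemma theta_fun_subproof (x : theta_obj A) : theta_pred (f (val x)).
Proof.
case: x => x /= /theta_predP ex; apply/theta_predP => g g'.
by rewrite shomE -!gmapE => e1 e2; congr (f _); apply: ex; rewrite -?gmapE.
Qed.

Definition theta_fun (x : theta_obj A) : theta_obj B :=
  exist _ (f (val x)) (theta_fun_subproof x).

Lemma theta_funE g x : theta_fun (g *> x) = g *> theta_fun x.
Proof. by apply: val_inj; rewrite /= gmapE. Qed.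

Lemma theta_hom_subproof x :
  sproj (theta_obj B) (Gmap theta_funE x) = sproj (theta_obj A) x.
Proof. by rewrite /= shomE. Qed.

Definition theta_hom : slice_hom (theta_obj A) (theta_obj B) :=
  SliceHom theta_hom_subproof.
End ThetaHom.

Definition theta_functor : functor (slice X) (slice X).
Proof.
refine (@Functor (slice X) (slice X) theta_obj theta_hom _ _).
- by move=> A; apply: slice_homP => x; apply: val_inj.
- by move=> *; apply: slice_homP => x; apply: val_inj.
Defined.
End Theta.

Section DepProd.
Variables (H : finGroupType) (V Y : gset H) (f : gmap V Y).

Definition fiber (y : Y) : finType := {v : V | f v == y}.

Section PiObj.
Variable (B : slice_obj V).

Definition section (y : Y) : finType :=
  {s : {ffun fiber y -> B} | [forall v, sproj B (s v) == val v]}.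

Definition pi_set : finType := {y : Y & section y}.

Definition pi_app (p : pi_set) (v : V) (vp : f v == tag p) : B :=
  val (tagged p) (exist _ v vp).

Lemma sproj_pi_app (p : pi_set) v (vp : f v == tag p) :
  sproj B (pi_app vp) = v.
Proof. by rewrite /pi_app; case: (tagged p) => s /= /forallP/(_ _)/eqP ->. Qed.

Lemma pi_setP (p q : pi_set) :
  tag p = tag q ->
  (forall v (vp : f v == tag p) (vq : f v == tag q), pi_app vp = pi_app vq) ->
  p = q.
Proof.
case: p q => [y s] [y' s'] /= eyy; case: y' / eyy s' => s' e.
congr (Tagged _ _); apply/val_inj/ffunP => -[v vp]; exact: e.
Qed.

Lemma fiber_act_subproof (h : H) (y : Y) (v : fiber (h *> y)) :
  f (h^-1 *> val v) == y.
Proof. by rewrite gmapE (eqP (valP v)) gactK. Qed.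

Definition fiber_act (h : H) (y : Y) (v : fiber (h *> y)) : fiber y :=
  exist _ (h^-1 *> val v) (fiber_act_subproof v).

Lemma section_act_subproof (h : H) (y : Y) (s : section y) :
  [forall v, sproj B ([ffun v : fiber (h *> y) => h *> val s (fiber_act v)] v)
             == val v].
Proof.
apply/forallP=> v; rewrite ffunE gmapE.
by rewrite (eqP (forallP (valP s) _)) /= gactKV.
Qed.

Definition section_act (h : H) (y : Y) (s : section y) : section (h *> y) :=
  exist _ [ffun v : fiber (h *> y) => h *> val s (fiber_act v)]
    (section_act_subproof h s).

Definition pi_act (h : H) (p : pi_set) : pi_set :=
  Tagged section (section_act h (tagged p)).

Lemma pi_app_irr (p : pi_set) v v' (vp : f v == tag p) (vp' : f v' == tag p) :
  v = v' -> pi_app vp = pi_app vp'.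
Proof.
by move=> e; rewrite /pi_app; congr (val (tagged p) _); apply: val_inj.
Qed.

Lemma pi_app_act h (p : pi_set) v
  (vp : f v == tag (pi_act h p)) (vp' : f (h^-1 *> v) == tag p) :
  pi_app vp = h *> pi_app vp'.
Proof.
rewrite /pi_app /= ffunE; congr (_ *> val (tagged p) _); exact: val_inj.
Qed.

Lemma pi_act1 p : pi_act 1 p = p.
Proof.
apply: pi_setP => [|v vp vq]; first by rewrite /= gact1.
have vp' : f (1^-1 *> v) == tag p by rewrite invg1 gact1.
by rewrite (pi_app_act _ vp') gact1; apply: pi_app_irr; rewrite invg1 gact1.
Qed.

Lemma pi_actM h k p : pi_act (h * k) p = pi_act h (pi_act k p).
Proof.
apply: pi_setP => [|v vp vq]; first by rewrite /= gactM.
have v1 : f ((h * k)^-1 *> v) == tag p.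
  by rewrite gmapE (eqP vp) /= gactK.
have v2 : f (h^-1 *> v) == tag (pi_act k p).
  by rewrite gmapE (eqP vq) /= gactK.
have v3 : f (k^-1 *> (h^-1 *> v)) == tag p by rewrite -gactM -invMg.
rewrite (pi_app_act vp v1) (pi_app_act vq v2) (pi_app_act v2 v3) gactM.
by congr (_ *> (_ *> _)); apply: pi_app_irr; rewrite -gactM -invMg.
Qed.

Definition pi_gset : gset H := Gset pi_act1 pi_actM.

Definition pi_proj : gmap pi_gset Y :=
  @Gmap H pi_gset Y (fun p : pi_set => tag p) (fun _ _ => erefl).

Definition pi_obj : slice_obj Y := SliceObj pi_proj.
End PiObj.

Section PiHom.
Variables (B B' : slice_obj V) (k : slice_hom B B').

Lemma section_comp_subproof (y : Y) (s : section B y) :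
  [forall v, sproj B' ([ffun v : fiber y => k (val s v)] v) == val v].
Proof. by apply/forallP=> v; rewrite ffunE shomE (forallP (valP s)). Qed.

Definition section_comp (y : Y) (s : section B y) : section B' y :=
  exist _ [ffun v : fiber y => k (val s v)] (section_comp_subproof s).

Definition pi_fun (p : pi_obj B) : pi_obj B' :=
  Tagged (section B') (section_comp (tagged p)).

Lemma pi_app_fun (p : pi_obj B) v (vp : f v == tag p) :
  @pi_app B' (pi_fun p) v vp = k (pi_app vp).
Proof. by rewrite /pi_app /= ffunE. Qed.

Lemma pi_funE h p : pi_fun (h *> p) = h *> pi_fun p.
Proof.
apply: pi_setP => // v vp vq.
have v1 : f (h^-1 *> v) == tag p by rewrite gmapE (eqP vp) /= gactK.
rewrite (pi_app_fun (p := h *> p)) (pi_app_act _ v1).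
by rewrite (@pi_app_act B' h (pi_fun p) v vq v1) pi_app_fun gmapE.
Qed.

Definition pi_hom : slice_hom (pi_obj B) (pi_obj B') :=
  @SliceHom H Y (pi_obj B) (pi_obj B') (Gmap pi_funE) (fun _ => erefl).
End PiHom.

Definition Pi : functor (slice V) (slice Y).
Proof.
refine (@Functor (slice V) (slice Y) pi_obj pi_hom _ _).
- move=> B; apply: slice_homP => p; apply: pi_setP => // v vp vq.
  by rewrite pi_app_fun; apply: pi_app_irr.
- move=> B B' B'' k k'; apply: slice_homP => p; apply: pi_setP => // v vp vq.
  rewrite /= (@pi_app_fun B' B'' k (pi_fun k' p) v vq).
  by rewrite !pi_app_fun /=; congr (k (k' _)); apply: pi_app_irr.
Defined.
End DepProd.

Definition push_bullet (G H : finGroupType) (X : gset G) (Y : gset H)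
  (a : cell1 X Y) : functor (slice X) (slice Y) :=
  fcomp (Pi (SIm_map a)) (fcomp (Sfun a) (theta_functor a)).

(* Main.v *)
Require Import Defs.
From mathcomp Require Import all_boot all_fingroup.
From mathcomp Require Import generic_quotient.
From mathcomp Require boolp.
(* This import makes gact1 and gactM the lemmas on left G-sets rather than their
   namesakes on group actions. *)
Import Defs.

(** Read X/G as the action groupoid of X, with an arrow g : x -> g x for every
g and x; 1-cells are then functors and 2-cells natural transformations. Testing
the bipullback property on a one-point 0-cell shows that the comparison functor
from W/L to the iso-comma groupoid of alpha and beta is essentially surjective
and full: up to isomorphism every (x, y, t) with beta y = t alpha x comes from
some w (bipullback_ess_surj), and every compatible pair of arrows g, h comes
from an arrow of W/L (bipullback_full).

Both base change formulas then factor through SIm. The assignment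
[h, w] |-> [tau(h) kappa_w, gamma w] is a 1-cell q from SIm(delta)/H to
SIm(alpha)/K, and
<<
     SIm(delta) --q--> SIm(alpha)
         |                 |
         Y   --beta-->     Z
>>
is a strict pullback of sets: injectivity of SIm(delta) -> Y x_Z SIm(alpha) is
bipullback_full, surjectivity is bipullback_ess_surj. Along a strict pullback,
beta^* commutes with both postcomposition (post_pull_iso) and dependent product
(pull_pi_iso), because the fibre of SIm(delta) over y is carried bijectively to
the fibre of SIm(alpha) over beta y. Two comparisons remain upstairs:
 - S_nu after gamma^* is q^* after S_theta (S_pull_iso);
 - gamma^* commutes with the endofunctors (-)^theta and (-)^nu
   (pull_theta_iso). Indeed a lies in A^theta when every g fixing x and killed
   by theta_x fixes a, and such g at x = gamma w are exactly the mu_w(l) for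
   the l fixing w and killed by nu_w.
Pasting the first comparison with post_pull_iso gives the formula for (-)_+;
pasting both with pull_pi_iso gives the one for (-)_bullet. *)

Set Implicit Arguments.
Unset Strict Implicit.
Unset Printing Implicit Defensive.

Local Open Scope group_scope.
Local Open Scope functor_scope.

(** * Natural isomorphisms and slice categories *)

Lemma slice_bij_iso (G : finGroupType) (X : gset G) (A B : slice X)
  (f : hom A B) :
  injective (f : slice_hom A B) ->
  (forall b, exists a, (f : slice_hom A B) a = b) -> is_iso f.
Proof.
move=> injf surjf.
have ex b : exists a, (f : slice_hom A B) a == b.
  by have [a <-] := surjf b; exists a.
pose g b := xchoose (ex b).
have gK b : (f : slice_hom A B) (g b) = b by apply/eqP/(xchooseP (ex b)).
have gE h b : g (h *> b) = h *> g b.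
  by apply: injf; rewrite gmapE !gK.
have go b : sproj A (Gmap gE b) = sproj B b by rewrite -(shomE f) gK.
exists (SliceHom go); split; apply: slice_homP => x /=; last exact: gK.
by apply: injf; rewrite gK.
Qed.

Section NatIso.
Variables C D E : category.

(** The inverses of the components exist only as propositions, so a choice
principle is needed to assemble them into a family. *)
Lemma nat_iso_sym (F F' : functor C D) : F ≅ F' -> F' ≅ F.
Proof.
move=> [eta [nat /(_ _)/boolp.cid iso]].
exists (fun A => sval (iso A)); split=> [A B f|A].
- case: (iso A) (iso B) => u [_ uK] [v [vK _]] /=.
  rewrite -[fmap F f]comp1c -vK -[compc (compc v _) _]compcA -nat.
  by rewrite compcA -[LHS]compcA uK compc1.
- by case: (iso A) => u [uK uK'] /=; exists (eta A).
Qed.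

Lemma nat_iso_trans (F F' F'' : functor C D) : F ≅ F' -> F' ≅ F'' -> F ≅ F''.
Proof.
move=> [eta [nat iso]] [eta' [nat' iso']].
exists (fun A => compc (eta' A) (eta A)); split=> [A B f|A].
  by rewrite compcA nat' -compcA nat compcA.
have [u [uK uK']] := iso A; have [v [vK vK']] := iso' A.
exists (compc u v); split.
  by rewrite -compcA (compcA v) vK comp1c.
by rewrite -compcA (compcA (eta A)) uK' comp1c.
Qed.

Lemma nat_iso_whiskerL (M : functor D E) (F F' : functor C D) :
  F ≅ F' -> M \of F ≅ M \of F'.
Proof.
move=> [eta [nat iso]]; exists (fun A => fmap M (eta A)).
split=> [A B f|A] /=; first by rewrite -!fmap_comp nat.
have [u [uK uK']] := iso A; exists (fmap M u).
by rewrite /= -!fmap_comp uK uK' !fmap_id.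
Qed.

Lemma nat_iso_whiskerR (F F' : functor D E) (M : functor C D) :
  F ≅ F' -> F \of M ≅ F' \of M.
Proof.
move=> [eta [nat iso]]; exists (fun A => eta (M A)).
by split=> [A B f|A]; [exact: nat | exact: iso].
Qed.
End NatIso.

Lemma fcompA (C D E E' : category) (F : functor E E') (F' : functor D E)
  (F'' : functor C D) : F \of (F' \of F'') ≅ F \of F' \of F''.
Proof.
exists (fun A => idc _); split=> [A B f|A]; first by rewrite compc1 comp1c.
by exists (idc _); rewrite compc1.
Qed.

(** * The bipullback property tested on points *)

Section Points.
Variables (G : finGroupType) (X : gset G).

Definition pt_gset : gset {perm void} :=
  @Gset {perm void} unit (fun _ x => x) (fun _ => erefl) (fun _ _ _ => erefl).

Lemma pt_cell_fun_subproof (x : X) (g : {perm void}) (u : pt_gset) :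
  x = 1 *> x.
Proof. by rewrite gact1. Qed.

Lemma pt_cell_grp_subproof (u : pt_gset) (g g' : {perm void}) :
  1 = 1 * 1 :> G.
Proof. by rewrite mulg1. Qed.

Definition pt_cell (x : X) : cell1 pt_gset X :=
  @Cell1 _ _ pt_gset X (fun _ => x) (fun _ _ => 1) (pt_cell_fun_subproof x)
    pt_cell_grp_subproof.
End Points.

Section PointCell2.
Variables (H H' G : finGroupType) (Y : gset H) (Y' : gset H') (X : gset G).
Variables (a : cell1 Y X) (a' : cell1 Y' X) (y : Y) (y' : Y') (e : G).
Hypothesis ae : a' y' = e *> a y.

Lemma pt_cell2_subproof :
  is_cell2 (c1comp a (pt_cell y)) (c1comp a' (pt_cell y')) (fun _ => e).
Proof. by split=> //= _ _; rewrite !c1grp1 mulg1 mulgV. Qed.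

(** An arrow e : a y -> a' y' of the target groupoid, seen as a 2-cell between
the constant 1-cells at its two ends. The domains of a and a' may differ, so
that arrows alpha x -> beta y are covered as well. *)
Definition pt_cell2 : cell2 (c1comp a (pt_cell y)) (c1comp a' (pt_cell y')) :=
  exist _ _ pt_cell2_subproof.
End PointCell2.

Section Square.
Variables (L G H K : finGroupType).
Variables (W : gset L) (X : gset G) (Y : gset H) (Z : gset K).
Variables (c : cell1 W X) (d : cell1 W Y) (a : cell1 X Z) (b : cell1 Y Z).
Variable (k : cell2 (c1comp a c) (c1comp b d)).

(** Essential surjectivity of the comparison from W/L to the iso-comma groupoid
of a and b, whose objects are the (x, y, t : a x -> b y). *)
Definition square_ess_surj : Prop := forall x y (t : K), b y = t *> a x ->
  exists w g h, [/\ x = g *> c w, y = h *> d w &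
    t * c1grp a (c w) g = c1grp b (d w) h * sval k w].

(** Fullness of the same comparison functor. *)
Definition square_full : Prop := forall w w' (g : G) (h : H),
  c w' = g *> c w -> d w' = h *> d w ->
  sval k w' * c1grp a (c w) g = c1grp b (d w) h * sval k w ->
  exists l, [/\ w' = l *> w, c1grp c w l = g & c1grp d w l = h].

(** An object (x, y, t) is a cone on the one-point 0-cell; its factorization
picks w, and the two 2-cells of the factorization are g and h. *)
Lemma bipullback_ess_surj : is_bipullback k -> square_ess_surj.
Proof.
move=> bp x y t bt.
have [[u [x1 [x2 /(_ tt) /= f]]] _] :=
  bp _ _ (pt_cell x) (pt_cell y) (pt_cell2 bt).
exists (u tt), (sval x1 tt), (sval x2 tt); split=> //.
- exact: (proj1 (svalP x1) tt).
- exact: (proj1 (svalP x2) tt).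
Qed.

(** Both w, with (g, h), and w', with identities, factor the cone
(c w', d w', kappa_w') on the one-point 0-cell; the comparison 2-cell between
these two factorizations is the arrow l. *)
Lemma bipullback_full : is_bipullback k -> square_full.
Proof.
move=> bp w w' g h cg dh kgh.
have c1 : c w' = 1 *> c w' by rewrite gact1.
have d1 : d w' = 1 *> d w' by rewrite gact1.
have [_ /(_ (pt_cell w) (pt_cell w') (pt_cell2 cg) (pt_cell2 dh)
   (pt_cell2 c1) (pt_cell2 d1))] := bp _ _ (c1comp c (pt_cell w'))
     (c1comp d (pt_cell w')) (whiskerR k (pt_cell w')).
case=> [_ //|u|z [[/(_ tt) /= z1 /(_ tt) /= z2] _]].
  by rewrite /= !c1grp1 mulg1 mul1g.
exists (sval z tt); split; last 2 first.
- by rewrite -z1 mul1g.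
- by rewrite -z2 mul1g.
- exact: (proj1 (svalP z) tt).
Qed.

Lemma cell2_funE w : b (d w) = sval k w *> a (c w).
Proof. by case: k => e [/= e1 _]. Qed.

Lemma cell2_grpE w l :
  sval k (l *> w) * c1grp a (c w) (c1grp c w l) =
  c1grp b (d w) (c1grp d w l) * sval k w.
Proof. by case: k => e [/= _ <-]; rewrite mulgKV. Qed.
End Square.

(** * Base change along a strict pullback *)

Section PiIntro.
Variables (H : finGroupType) (V Y : gset H) (f : gmap V Y) (B : slice_obj V).

Lemma eq_pi_app (p p' : pi_obj f B) v (vp : f v == tag p) (vp' : f v == tag p') :
  p = p' -> pi_app vp = pi_app vp'.
Proof. by move=> e; case: p' / e vp' => vp'; apply: pi_app_irr. Qed.

Variables (y : Y) (s : forall v, f v == y -> B).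
Hypothesis sK : forall v (vy : f v == y), sproj B (s vy) = v.

Lemma pi_mk_subproof :
  [forall v, sproj B ([ffun v : fiber f y => s (valP v)] v) == val v].
Proof. by apply/forallP=> v; rewrite ffunE sK. Qed.

Definition pi_mk : pi_obj f B :=
  Tagged (section f B)
    (exist _ [ffun v : fiber f y => s (valP v)] pi_mk_subproof : section f B y).

Lemma pi_app_mk v (vy : f v == tag pi_mk) : pi_app vy = s vy.
Proof.
by rewrite /pi_app /= ffunE /=; congr (s _); apply: bool_irrelevance.
Qed.
End PiIntro.

(** Here V' is the pullback of V along b. As b is a 1-cell between sets with
actions of different groups, so is the projection q from V' to V: H acts on V
only through the group maps of b, which is what qE says. *)
Section StrictPullback.
Variables (H K : finGroupType) (Y : gset H) (Z : gset K) (b : cell1 Y Z).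
Variables (V : gset K) (V' : gset H) (f : gmap V Z) (f' : gmap V' Y).
Variable q : cell1 V' V.
Hypothesis fq : forall v, f (q v) = b (f' v).
Hypothesis qE : forall v h, c1grp q v h = c1grp b (f' v) h.
Hypothesis fq_inj : forall v1 v2, f' v1 = f' v2 -> q v1 = q v2 -> v1 = v2.
Hypothesis fq_surj : forall y v, b y = f v -> exists v', f' v' = y /\ q v' = v.

Section PostPull.
Variable B : slice_obj V.

Lemma post_pull_fun_subproof (p : pull_obj q B) :
  b (f' (val p).1) == sproj (post_obj f B) (val p).2.
Proof. by rewrite /= -(eqP (valP p)) fq. Qed.

Definition post_pull_fun (p : pull_obj q B) : pull_obj b (post_obj f B) :=
  exist _ (f' (val p).1, (val p).2) (post_pull_fun_subproof p).

Lemma post_pull_funE h p : post_pull_fun (h *> p) = h *> post_pull_fun p.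
Proof. by apply: val_inj; rewrite /= gmapE qE. Qed.

Definition post_pull_hom :
  slice_hom (post_obj f' (pull_obj q B)) (pull_obj b (post_obj f B)) :=
  @SliceHom H Y (post_obj f' (pull_obj q B)) (pull_obj b (post_obj f B))
    (Gmap post_pull_funE) (fun _ => erefl).
End PostPull.

(** Both sides are, over y, pairs of a point of V over b y and a point of B
above it. *)
Lemma post_pull_iso : postcomp f' \of pull q ≅ pull b \of postcomp f.
Proof.
exists post_pull_hom; split=> [B B' g|B].
  by apply: slice_homP => p; apply: val_inj.
apply: slice_bij_iso => [p p' /(congr1 val)[e1 e2]|[[y x] yx]].
  apply: val_inj; rewrite [LHS]surjective_pairing [RHS]surjective_pairing.
  rewrite e2 (@fq_inj (val p).1 (val p').1) //.
  by rewrite (eqP (valP p)) (eqP (valP p')) e2.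
have [v [vy vx]] := fq_surj (eqP yx).
have vx' : q v == sproj B x by rewrite vx.
by exists (exist _ (v, x) vx'); apply: val_inj; rewrite /= vy.
Qed.

Section PullPi.
Variable B : slice_obj V.

Section Fun.
Variable p : pull_obj b (pi_obj f B).

Lemma pull_pi_fiber_subproof v :
  f' v == (val p).1 -> f (q v) == tag (val p).2.
Proof. by move=> /eqP e; rewrite fq e (eqP (valP p)). Qed.

Lemma pull_pi_elt_subproof v (vy : f' v == (val p).1) :
  q v == sproj B (pi_app (pull_pi_fiber_subproof vy)).
Proof. by rewrite sproj_pi_app. Qed.

Definition pull_pi_elt v (vy : f' v == (val p).1) : pull_obj q B :=
  exist _ (v, pi_app (pull_pi_fiber_subproof vy)) (pull_pi_elt_subproof vy).

Definition pull_pi_fun : pi_obj f' (pull_obj q B) :=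
  pi_mk (s := pull_pi_elt) (fun _ _ => erefl).
End Fun.

Lemma pull_pi_app p v (vp : f' v == (val p).1) (vq : f (q v) == tag (val p).2) :
  val (@pi_app _ _ _ f' (pull_obj q B) (pull_pi_fun p) v vp) = (v, pi_app vq).
Proof. by rewrite pi_app_mk; congr pair; apply: pi_app_irr. Qed.

Lemma pull_pi_funE h p : pull_pi_fun (h *> p) = h *> pull_pi_fun p.
Proof.
apply: pi_setP => //= v vp vp'; apply: val_inj.
have v1 : f' (h^-1 *> v) == (val p).1 by rewrite gmapE (eqP vp) gactK.
have v2 := pull_pi_fiber_subproof (p := h *> p) vp.
have v3 := pull_pi_fiber_subproof v1.
rewrite (pull_pi_app (p := h *> p) vp v2).
rewrite (@pi_app_act _ _ _ f' (pull_obj q B) h (pull_pi_fun p) v vp' v1) /=.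
rewrite (pull_pi_app v1 v3) /= gactKV; congr pair.
(* h acts on p through c1grp b y h, with y the base point of p, while q moves
   h^-1 *> v by c1grp q v h^-1: these are mutually inverse. *)
have hE : c1grp b (val p).1 h = (c1grp q v h^-1)^-1.
  by rewrite qE (eqP vp) /= c1grpV invgK.
have v4 : f ((c1grp b (val p).1 h)^-1 *> q v) == tag (val p).2.
  by rewrite hE invgK -c1funE.
rewrite (pi_app_act (p := (val p).2) _ v4) qE (eqP v1); congr (_ *> _).
by apply: pi_app_irr; rewrite hE invgK c1funE.
Qed.

Lemma pull_pi_fun_inj : injective pull_pi_fun.
Proof.
move=> p p' e.
have e1 : (val p).1 = (val p').1 := congr1 (@tag _ _) e.
apply: val_inj; rewrite [LHS]surjective_pairing [RHS]surjective_pairing.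
congr pair => //; apply: pi_setP => [|v].
  exact: etrans (esym (eqP (valP p))) (etrans (congr1 b e1) (eqP (valP p'))).
move=> vp vp'; have [v' [v'y v'v]] : exists v', f' v' = (val p).1 /\ q v' = v.
  by apply: fq_surj; rewrite (eqP vp); apply: (eqP (valP p)).
case: v / v'v vp vp' => vp vp'.
have yv : f' v' == (val p).1 by rewrite v'y.
have yv' : f' v' == (val p').1 by rewrite v'y e1.
have := eq_pi_app (p := pull_pi_fun p) (p' := pull_pi_fun p') yv yv' e.
move=> /(congr1 val).
by rewrite (pull_pi_app _ vp) (pull_pi_app _ vp') => -[].
Qed.

(** A section over y of the pulled back family determines one over b y: at a
point v over b y, take its value at the unique point of V' above (y, v). *)
Lemma pull_pi_fun_surj (r : pi_obj f' (pull_obj q B)) :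
  exists p, pull_pi_fun p = r.
Proof.
have lift v : f v == b (tag r) -> exists v', (f' v' == tag r) && (q v' == v).
  move=> /eqP e; have [v' [<- <-]] := fq_surj (esym e).
  by exists v'; rewrite !eqxx.
pose lft v vy := xchoose (@lift v vy).
have lft_f v vy : f' (lft v vy) == tag r by case/andP: (xchooseP (@lift v vy)).
have lft_q v vy : q (lft v vy) = v.
  by case/andP: (xchooseP (@lift v vy)) => _ /eqP.
pose s v vy : B := (val (pi_app (lft_f v vy))).2.
have sK v vy : sproj B (s v vy) = v.
  rewrite -(eqP (valP (pi_app (lft_f v vy)))) -[RHS](lft_q v vy); congr (q _).
  exact: (sproj_pi_app (B := pull_obj q B) (lft_f v vy)).
have rP : b (tag r) == sproj (pi_obj f B) (pi_mk sK) by [].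
exists (exist _ (tag r, pi_mk sK) rP : pull_obj b (pi_obj f B)).
apply: pi_setP => //= v vp vp'; apply: val_inj.
have qv : f (q v) == b (tag r) by rewrite fq (eqP vp').
rewrite (pull_pi_app (p := exist _ (tag r, pi_mk sK) rP) vp qv) pi_app_mk /s.
have e : lft (q v) qv = v.
  by apply: fq_inj; rewrite ?(eqP (lft_f _ _)) ?(eqP vp').
rewrite (@pi_app_irr _ _ _ _ (pull_obj q B) r _ _ (lft_f (q v) qv) vp' e).
rewrite [RHS]surjective_pairing.
by congr pair; exact: esym (sproj_pi_app (B := pull_obj q B) vp').
Qed.

Definition pull_pi_hom :
  slice_hom (pull_obj b (pi_obj f B)) (pi_obj f' (pull_obj q B)) :=
  @SliceHom H Y (pull_obj b (pi_obj f B)) (pi_obj f' (pull_obj q B))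
    (Gmap pull_pi_funE) (fun _ => erefl).
End PullPi.

(** Beck-Chevalley for dependent products: sections over the fibre of f' at y
are sections over the fibre of f at b y, since q identifies the two fibres. *)
Lemma pull_pi_iso : pull b \of Pi f ≅ Pi f' \of pull q.
Proof.
exists pull_pi_hom; split=> [B B' g|B].
  apply: slice_homP => p; apply: pi_setP => //= v vp vp'; apply: val_inj.
  have v1 := pull_pi_fiber_subproof (p := p) vp.
  rewrite (@pi_app_fun _ _ _ f' _ _ (pull_hom q g) (pull_pi_fun p) v vp) /=.
  rewrite (pull_pi_app _ v1) /=.
  rewrite (@pull_pi_app B' (pull_fun (a := b) (pi_hom f g) p) v vp' v1).
  by rewrite pi_app_fun.
by apply: slice_bij_iso; [exact: pull_pi_fun_inj | exact: pull_pi_fun_surj].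
Qed.
End StrictPullback.

(** * The square of stable images *)

Section IndRec.
Variables (G H : finGroupType) (X : gset G) (Y : gset H) (a : cell1 X Y).
Variables (A : slice_obj X) (T : Type) (F : H -> A -> T).
Hypothesis F_inv : forall h x g,
  F (h * c1grp a (sproj A x) g) x = F h (g *> x).

Definition ind_rec (c : ind_gset a A) : T := F (repr c).1 (repr c).2.

Lemma ind_recE h x : ind_rec (ind_class a h x) = F h x.
Proof.
have /ind_classP[g [e1 e2]] := ind_class_repr (ind_class a h x).
by rewrite /ind_rec e2 F_inv -e1.
Qed.
End IndRec.

Section Comparison.
Variables (L G H K : finGroupType).
Variables (W : gset L) (X : gset G) (Y : gset H) (Z : gset K).
Variables (c : cell1 W X) (d : cell1 W Y) (a : cell1 X Z) (b : cell1 Y Z).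
Variable k : cell2 (c1comp a c) (c1comp b d).

(** The arrow a (c w) -> b (h *> d w) obtained from kappa_w followed by h. *)
Definition transport (h : H) (w : W) : K := c1grp b (d w) h * sval k w.

(** Naturality of kappa at the arrow l: it makes [h, w] |-> [transport h w, c w]
well defined. *)
Lemma transport_inv h w l :
  transport (h * c1grp d w l) w =
  transport h (l *> w) * c1grp a (c w) (c1grp c w l).
Proof. by rewrite /transport -mulgA cell2_grpE mulgA c1grpM c1funE. Qed.

Lemma transport_mul h h' w :
  transport (h * h') w = c1grp b (h' *> d w) h * transport h' w.
Proof. by rewrite /transport c1grpM mulgA. Qed.

Section IndCompare.
Variable A : slice_obj X.

Lemma S_compare_inv (h : H) (p : pull_obj c A) l :
  ind_class a (transport (h * c1grp d (sproj (pull_obj c A) p) l) (val p).1)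
    (val p).2 =
  ind_class a (transport h (val (l *> p)).1) (val (l *> p)).2.
Proof.
apply/ind_classP; exists (c1grp c (val p).1 l); split=> //.
by rewrite /= transport_inv (eqP (valP p)).
Qed.

Definition S_compare : ind_gset d (pull_obj c A) -> ind_gset a A :=
  ind_rec (fun h (p : pull_obj c A) =>
    ind_class a (transport h (val p).1) (val p).2).

Lemma S_compare_class h (p : pull_obj c A) :
  S_compare (ind_class d h p) =
  ind_class a (transport h (val p).1) (val p).2.
Proof. exact: (ind_recE S_compare_inv). Qed.
End IndCompare.

Lemma S_compare_nat (A B : slice_obj X) (f : slice_hom A B) v :
  ind_map a f (S_compare v) = S_compare (ind_map d (pull_hom c f) v).
Proof.
elim/ind_ind: v => h p.
by rewrite /= [in RHS]ind_fun_class !S_compare_class ind_fun_class.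
Qed.

Lemma SIm_compare_inv (h : H) (w : slice_top W) l :
  ind_class a (transport (h * c1grp d (sproj (slice_top W) w) l) w)
    (c w : slice_top X) =
  ind_class a (transport h (l *> w)) (c (l *> w) : slice_top X).
Proof.
by apply/ind_classP; exists (c1grp c w l); rewrite -c1funE transport_inv.
Qed.

Definition SIm_compare_fun : SIm d -> SIm a :=
  ind_rec (fun h (w : slice_top W) =>
    ind_class a (transport h w) (c w : slice_top X)).

Lemma SIm_compare_class h (w : slice_top W) :
  SIm_compare_fun (ind_class d h w) =
  ind_class a (transport h w) (c w : slice_top X).
Proof. exact: (ind_recE SIm_compare_inv). Qed.

Lemma SIm_compare_funE h v :
  SIm_compare_fun (h *> v) = c1grp b (SIm_map d v) h *> SIm_compare_fun v.
Proof.
elim/ind_ind: v => h' w; rewrite /= ind_actE !SIm_compare_class SIm_fun_class.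
by rewrite ind_actE transport_mul.
Qed.

Lemma SIm_compare_grpM (v : SIm d) h h' :
  c1grp b (SIm_map d v) (h * h') =
  c1grp b (SIm_map d (h' *> v)) h * c1grp b (SIm_map d v) h'.
Proof. by rewrite c1grpM gmapE. Qed.

Definition SIm_compare : cell1 (SIm d) (SIm a) :=
  Cell1 SIm_compare_funE SIm_compare_grpM.

Lemma SIm_compare_over v :
  SIm_map a (SIm_compare v) = b (SIm_map d v).
Proof.
elim/ind_ind: v => h w /=; rewrite SIm_compare_class !SIm_fun_class.
by rewrite c1funE (cell2_funE k) gactM.
Qed.

Hypothesis k_ess_surj : square_ess_surj k.
Hypothesis k_full : square_full k.

(** The form in which fullness is used: it is the common core of the injectivity
of every comparison map defined on classes [h, w]. *)
Lemma transport_full h w h' w' g :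
  h *> d w = h' *> d w' -> c w' = g *> c w ->
  transport h w = transport h' w' * c1grp a (c w) g ->
  exists l, [/\ w' = l *> w, c1grp c w l = g & h = h' * c1grp d w l].
Proof.
move=> dh cg th.
have dh' : d w' = (h'^-1 * h) *> d w by rewrite gactM dh gactK.
case: (k_full cg dh') => [|l [lw lg lh]].
  apply: (mulgI (c1grp b (d w') h')).
  by rewrite mulgA -/(transport h' w') -th {1}dh' [RHS]mulgA -c1grpM mulKVg.
by exists l; rewrite lh mulKVg.
Qed.

(** With SIm_compare_surj, the square of stable images over b is a strict
pullback. *)
Lemma SIm_compare_inj v v' :
  SIm_map d v = SIm_map d v' -> SIm_compare v = SIm_compare v' -> v = v'.
Proof.
elim/ind_ind: v => h w; elim/ind_ind: v' => h' w' /=.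
rewrite !SIm_fun_class !SIm_compare_class => dh.
move=> /(ind_classP a (A := slice_top X))[g [cg th]].
have [l [lw _ lh]] := transport_full dh cg th.
by apply/(ind_classP d (A := slice_top W)); exists l.
Qed.

Lemma SIm_compare_surj y v : b y = SIm_map a v ->
  exists v', SIm_map d v' = y /\ SIm_compare v' = v.
Proof.
elim/ind_ind: v => t x /=; rewrite SIm_fun_class.
move=> /k_ess_surj[w [g [h [-> -> e]]]].
exists (ind_class d h (w : slice_top W)) => /=.
rewrite SIm_fun_class SIm_compare_class; split=> //.
by apply/(ind_classP a (A := slice_top X)); exists g; rewrite e.
Qed.

(** * The comparison of S_theta and S_nu *)

Section SHom.
Variable A : slice_obj X.

Lemma S_pull_fun_subproof (v : S_obj d (pull_obj c A)) :
  SIm_compare (sproj (S_obj d (pull_obj c A)) v) ==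
  sproj (S_obj a A) (S_compare v).
Proof.
elim/ind_ind: v => h p; apply/eqP.
rewrite /= ind_fun_class S_compare_class ind_fun_class SIm_compare_class /=.
by rewrite (eqP (valP p)).
Qed.

Definition S_pull_fun (v : S_obj d (pull_obj c A)) :
  pull_obj SIm_compare (S_obj a A) :=
  exist _ (sproj (S_obj d (pull_obj c A)) v, S_compare v)
    (S_pull_fun_subproof v).

Lemma S_pull_funE h v : S_pull_fun (h *> v) = h *> S_pull_fun v.
Proof.
apply: val_inj; rewrite /= ind_funE; congr pair.
elim/ind_ind: v => h' p; rewrite /= ind_actE !S_compare_class ind_fun_class.
by rewrite SIm_fun_class ind_actE transport_mul.
Qed.

Definition S_pull_hom :
  slice_hom (S_obj d (pull_obj c A)) (pull_obj SIm_compare (S_obj a A)) :=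
  @SliceHom _ _ (S_obj d (pull_obj c A)) (pull_obj SIm_compare (S_obj a A))
    (Gmap S_pull_funE) (fun _ => erefl).

Lemma S_pull_fun_inj : injective S_pull_fun.
Proof.
move=> v v' /(congr1 val)/= [].
elim/ind_ind: v => h p; elim/ind_ind: v' => h' p'.
rewrite !ind_fun_class !S_compare_class /=.
move=> /(congr1 (SIm_map d)); rewrite /= !SIm_fun_class => dh.
move=> /ind_classP[g [xg th]].
rewrite -(eqP (valP p)) in th.
have cg : c (val p').1 = g *> c (val p).1.
  by rewrite (eqP (valP p')) (eqP (valP p)) xg gmapE.
have [l [lw lg lh]] := transport_full dh cg th.
apply/(ind_classP d (A := pull_obj c A)); exists l; split=> //.
apply: val_inj => /=.
by rewrite -lw lg -xg -surjective_pairing.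
Qed.

(** The class v = [h, w] already provides w, and the equation
q v = [t, x] says how to move the point above x to one above c w. *)
Lemma S_pull_fun_surj r : exists v, S_pull_fun v = r.
Proof.
case: r => -[v u]; elim/ind_ind: v => h w; elim/ind_ind: u => t x /= e.
have := eqP e; rewrite /= SIm_compare_class ind_fun_class.
case/(ind_classP a (A := slice_top X))=> g [/= xg th].
have cx : c w == sproj A (g^-1 *> x) by rewrite gmapE xg gactK.
exists (ind_class d h (exist _ (w, g^-1 *> x) cx : pull_obj c A)).
apply: val_inj; rewrite /= ind_fun_class S_compare_class /=; congr pair.
apply/ind_classP; exists g; rewrite gactKV; split=> //.
by rewrite -(eqP cx).
Qed.
End SHom.

Lemma S_pull_iso : Sfun d \of pull c ≅ pull SIm_compare \of Sfun a.
Proof.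
exists S_pull_hom; split=> [A B f|A].
  apply: slice_homP => v; have /= e := S_compare_nat f v.
  apply: val_inj; rewrite /= e.
  by congr pair; exact: esym (shomE (S_hom d (pull_hom c f)) v).
by apply: slice_bij_iso; [exact: S_pull_fun_inj | exact: S_pull_fun_surj].
Qed.

(** * The endofunctors (-)^theta and (-)^nu *)

(** The arrow l of W/L that fullness produces from g and 1 is what turns
invariance under the kernel of nu at w into invariance under the kernel of
theta at c w. *)
Lemma pull_theta_pred (A : slice_obj X) (p : pull_obj c A) :
  theta_pred d p = theta_pred a (val p).2.
Proof.
have cx := eqP (valP p); set w := (val p).1 in cx; set x := (val p).2 in cx *.
apply/theta_predP/theta_predP => /= [px g g' tg gx|px l l' dl wl].
- rewrite -cx in tg gx.
  (* Two elements with the same effect on c w and the same image in K differ by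
     one that comes from some l fixing w, with trivial image in H. *)
  have [|||l [lw lg lh]] := @k_full w w (g'^-1 * g) 1.
  + by rewrite gactM gx gactK.
  + by rewrite gact1.
  + rewrite c1grp1 mul1g c1grpM gx tg.
    by rewrite -c1grpM mulVg c1grp1 mulg1.
  have := px l 1; rewrite c1grp1 gact1 lh -lw => /(_ erefl erefl).
  move=> /(congr1 (fun p => (val p).2)) /=; rewrite c1grp1 gact1 lg gactM.
  by move/(congr1 (gact g')); rewrite gactKV.
- apply: val_inj => /=; congr pair => //; apply: px; rewrite -cx.
    apply: (mulgI (sval k (l *> w))); rewrite cell2_grpE dl -cell2_grpE.
    by rewrite wl.
  by rewrite -!c1funE wl.
Qed.

Section ThetaHom.
Variable A : slice_obj X.

Lemma pull_theta_pair_subproof (p : pull_obj c (theta_obj a A)) :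
  c (val p).1 == sproj A (val (val p).2).
Proof. exact: valP p. Qed.

Definition pull_theta_pair (p : pull_obj c (theta_obj a A)) : pull_obj c A :=
  exist _ ((val p).1, val (val p).2) (pull_theta_pair_subproof p).

Lemma pull_theta_fun_subproof (p : pull_obj c (theta_obj a A)) :
  theta_pred d (pull_theta_pair p).
Proof. rewrite pull_theta_pred; exact: valP (val p).2. Qed.

Definition pull_theta_fun (p : pull_obj c (theta_obj a A)) :
  theta_obj d (pull_obj c A) :=
  exist _ (pull_theta_pair p) (pull_theta_fun_subproof p).

Lemma pull_theta_funE l p : pull_theta_fun (l *> p) = l *> pull_theta_fun p.
Proof. by do 2 apply: val_inj. Qed.

Definition pull_theta_hom :
  slice_hom (pull_obj c (theta_obj a A)) (theta_obj d (pull_obj c A)) :=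
  @SliceHom _ _ (pull_obj c (theta_obj a A)) (theta_obj d (pull_obj c A))
    (Gmap pull_theta_funE) (fun _ => erefl).
End ThetaHom.

Lemma pull_theta_iso :
  pull c \of theta_functor a ≅ theta_functor d \of pull c.
Proof.
exists pull_theta_hom; split=> [A B f|A].
  by apply: slice_homP => p; do 2 apply: val_inj.
apply: slice_bij_iso.
  move=> p p' /(congr1 val)/(congr1 val) [e1 e2]; apply: val_inj.
  rewrite [LHS]surjective_pairing [RHS]surjective_pairing e1; congr pair.
  exact: val_inj.
move=> [p px]; have px' := px; rewrite pull_theta_pred in px'.
pose x : theta_obj a A := exist _ (val p).2 px'.
have cx : c (val p).1 == sproj (theta_obj a A) x := valP p.
exists (exist _ ((val p).1, x) cx : pull_obj c (theta_obj a A)).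
by do 2 apply: val_inj; rewrite /= -surjective_pairing.
Qed.

(** * Base change for the two pushforwards *)

Lemma push_plus_base_change :
  pull b \of push_plus a ≅ push_plus d \of pull c.
Proof.
apply: nat_iso_sym.
apply: nat_iso_trans (nat_iso_sym (fcompA _ _ _)) _.
apply: nat_iso_trans (nat_iso_whiskerL _ S_pull_iso) _.
apply: nat_iso_trans (fcompA _ _ _) _.
apply: nat_iso_trans (nat_iso_sym (fcompA _ _ _)).
apply: nat_iso_whiskerR; apply: post_pull_iso => //.
- exact: SIm_compare_over.
- exact: SIm_compare_inj.
- exact: SIm_compare_surj.
Qed.

(** Pi is moved past beta first, then S_theta and (-)^theta past q and gamma:
beta^* Pi S_theta (-)^theta = Pi q^* S_theta (-)^theta
= Pi S_nu gamma^* (-)^theta = Pi S_nu (-)^nu gamma^* up to isomorphism. *)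
Lemma push_bullet_base_change :
  pull b \of push_bullet a ≅ push_bullet d \of pull c.
Proof.
have pi_iso : pull b \of Pi (SIm_map a) ≅ Pi (SIm_map d) \of pull SIm_compare.
  apply: pull_pi_iso => //.
  - exact: SIm_compare_over.
  - exact: SIm_compare_inj.
  - exact: SIm_compare_surj.
apply: nat_iso_trans (fcompA _ _ _) _.
apply: nat_iso_trans (nat_iso_whiskerR _ pi_iso) _.
apply: nat_iso_trans (nat_iso_sym (fcompA _ _ _)) _.
apply: nat_iso_trans (fcompA _ _ _).
apply: nat_iso_whiskerL.
apply: nat_iso_trans (fcompA _ _ _) _.
apply: nat_iso_trans (nat_iso_whiskerR _ (nat_iso_sym S_pull_iso)) _.
apply: nat_iso_trans (nat_iso_sym (fcompA _ _ _)) _.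
apply: nat_iso_trans (fcompA _ _ _).
by apply: nat_iso_whiskerL; exact: pull_theta_iso.
Qed.
End Comparison.

Theorem proposition6p5
  (L G H K : finGroupType)
  (W : gset L) (X : gset G) (Y : gset H) (Z : gset K)
  (gamma_mu : cell1 W X) (delta_nu : cell1 W Y)
  (alpha_theta : cell1 X Z) (beta_tau : cell1 Y Z)
  (kappa : cell2 (alpha_theta \o gamma_mu)%cell (beta_tau \o delta_nu)%cell)
  (bipullback : is_bipullback kappa) :
  (pull beta_tau \of push_plus alpha_theta
     ≅ push_plus delta_nu \of pull gamma_mu)%F /\
  (pull beta_tau \of push_bullet alpha_theta
     ≅ push_bullet delta_nu \of pull gamma_mu)%F.
Proof.
have surj := bipullback_ess_surj bipullback.
have full := bipullback_full bipullback.
by split; [exact: push_plus_base_change surj full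
  | exact: push_bullet_base_change surj full].
Qed.
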